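(* Let $A$ be an abelian group and $L$ a loop with the inverse property, with identity $\epsilon$, containing no elements of order $3$. Let $\Sigma=\{(\xi,\epsilon):\xi\in L\}\cup\{(\epsilon,\xi):\xi\in L\}\cup\{(\xi^{-1},\xi):\xi\in L\}\subset L\times L$. Consider the following construction of maps $P,Q:L\times L\to\mathrm{Aut}(A)$: put $P(\xi,\eta)=Q(\xi,\eta)=\mathrm{Id}$ for all $(\xi,\eta)\in\Sigma$; in each orbit of $\Gamma$ in $(L\times L)\setminus\Sigma$ choose one element $(\xi,\eta)$ and choose the values $P(\xi,\eta),Q(\xi,\eta)\in\mathrm{Aut}(A)$ arbitrarily; and define the values at the other elements of the orbit by $$\big(P(\tau(\xi,\eta)),\,Q(\tau(\xi,\eta))\big)=\tau\big(P(\xi,\eta),\,Q(\xi,\eta)\big),\qquad \tau\in\Gamma.$$ Every strongly linear abelian extension $F(P,Q)$ determined by this construction has the inverse property. Conversely, every strongly linear abelian extension $F(P,Q)$ of $A$ by $L$ having the inverse property can be obtained by this construction.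
   Context: A loop is a set with a binary multiplication having a two-sided identity element such that all left and right translations are bijections. A loop $L$ has the left (resp. right) inverse property if there is a bijection $\iota:L\to L$ with $\iota(x)\cdot xy=y$ (resp. $yx\cdot\iota(x)=y$) for all $x,y\in L$; then left and right inverses of every $x$ coincide and $\iota(x)=x^{-1}$. It has the inverse property if it has both. In a loop with the inverse property and identity $\epsilon$, an element of order $3$ is an element $\xi\ne\epsilon$ with $\xi\xi\cdot\xi=\epsilon$. Let $A=(A,+)$ be a commutative group and $L$ a loop with identity $\epsilon$. A loop cocycle is a pair $(P,Q)$ of maps $P,Q:L\times L\to\mathrm{Aut}(A)$ with $P(\alpha,\epsilon)=\mathrm{Id}=Q(\epsilon,\beta)$ for all $\alpha,\beta\in L$. The linear abelian extension $F(P,Q)$ of $A$ by $L$ is the loop on $L\times A$ with multiplication $(\alpha,a)\cdot(\beta,b)=(\alpha\beta,\,P(\alpha,\beta)a+Q(\alpha,\beta)b)$. It is strongly linear abelian if $(\epsilon,a)\cdot(\beta,b)=(\beta,b)\cdot(\epsilon,a)=(\beta,a+b)$ for all $a,b\in A$, $\beta\in L$; equivalently $P(\xi,\epsilon)=P(\epsilon,\xi)=\mathrm{Id}=Q(\xi,\epsilon)=Q(\epsilon,\xi)$ for all $\xi\in L$. The group $\Gamma\cong S_3$ is generated by two involutions $\varphi,\psi$ with $(\varphi\psi)^3=1$. It acts on $L\times L$ (preserving $\Sigma$, and acting freely on $(L\times L)\setminus\Sigma$ since $L$ has no elements of order $3$) and on $\mathrm{Aut}(A)\times\mathrm{Aut}(A)$;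 its six elements act by (with $\mathcal P,\mathcal Q\in\mathrm{Aut}(A)$): - $\iota$: $(\xi,\eta)\mapsto(\xi,\eta)$; $(\mathcal P,\mathcal Q)\mapsto(\mathcal P,\mathcal Q)$. - $\varphi$: $(\xi,\eta)\mapsto(\xi^{-1},\xi\eta)$; $(\mathcal P,\mathcal Q)\mapsto(\mathcal Q^{-1}\mathcal P,\mathcal Q^{-1})$. - $\psi$: $(\xi,\eta)\mapsto(\xi\eta,\eta^{-1})$; $(\mathcal P,\mathcal Q)\mapsto(\mathcal P^{-1},\mathcal P^{-1}\mathcal Q)$. - $\varphi\psi\varphi$: $(\xi,\eta)\mapsto(\eta^{-1},\xi^{-1})$; $(\mathcal P,\mathcal Q)\mapsto(\mathcal Q,\mathcal P)$. - $\psi\varphi$: $(\xi,\eta)\mapsto(\eta,(\xi\eta)^{-1})$; $(\mathcal P,\mathcal Q)\mapsto(\mathcal P^{-1}\mathcal Q,\mathcal P^{-1})$. - $\varphi\psi$: $(\xi,\eta)\mapsto((\xi\eta)^{-1},\xi)$; $(\mathcal P,\mathcal Q)\mapsto(\mathcal Q^{-1},\mathcal Q^{-1}\mathcal P)$. *)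

(* Defs.v *)
From HB Require Import structures.
From mathcomp Require Import all_boot.
From mathcomp Require Import monoid ssralg.
From mathcomp Require Import boolp.

Set Implicit Arguments.
Unset Strict Implicit.
Unset Printing Implicit Defensive.

Import GRing.Theory.
Local Open Scope group_scope.

HB.mixin Record UMagma_isLoop L of UMagma L := {
  lmul_bij : forall x : L, bijective (fun y : L => x * y);
  rmul_bij : forall x : L, bijective (fun y : L => y * x)
}.

#[short(type="loopType")]
HB.structure Definition Loop := {L of UMagma_isLoop L & UMagma L}.

Section LoopTheory.
Context {L : loopType}.
Implicit Types x y : L.

Lemma linv_subproof x : exists y, x * y == 1.
Proof. by have [g _ gK] := lmul_bij x; exists (g 1); apply/eqP/gK. Qed.

(* The right inverse of [x]; under either inverse property it is also the
   left inverse, i.e. the two-sided inverse of [x]. *)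
Definition linv x : L := xchoose (linv_subproof x).

Lemma mul_linv x : x * linv x = 1.
Proof. exact/eqP/(xchooseP (linv_subproof x)). Qed.

End LoopTheory.

Definition left_inverse_property (L : loopType) : Prop :=
  exists iota : L -> L,
    bijective iota /\ forall x y : L, iota x * (x * y) = y.

Definition right_inverse_property (L : loopType) : Prop :=
  exists iota : L -> L,
    bijective iota /\ forall x y : L, (y * x) * iota x = y.

Definition inverse_property (L : loopType) : Prop :=
  left_inverse_property L /\ right_inverse_property L.

Section InverseProperty.
Context {L : loopType} (hIP : inverse_property L).
Implicit Types x y : L.

Lemma inverse_propertyP x y : linv x * (x * y) = y /\ (y * x) * linv x = y.
Proof.
have linj z : injective (fun t : L => z * t) by exact/bij_inj/lmul_bij.
case: hIP => [[i [_ iK]] [j [_ jK]]].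
have jE z : j z = linv z by apply: (linj z); rewrite mul_linv -{1}[z]mul1g jK.
have ijE z : i z = j z.
  have iz : i z * z = 1 by rewrite -[X in _ * X]mulg1 iK.
  by have := jK z (i z); rewrite iz mul1g.
by rewrite -{1}jE -{1}ijE iK -jE jK.
Qed.

Lemma linvKl x y : linv x * (x * y) = y.
Proof. by case: (inverse_propertyP x y). Qed.

Lemma linvKr x y : (y * x) * linv x = y.
Proof. by case: (inverse_propertyP x y). Qed.

Lemma linv_mul x : linv x * x = 1.
Proof. by rewrite -[X in _ * X]mulg1 linvKl. Qed.

Lemma linvK : involutive (@linv L).
Proof.
move=> x; have := linvKl (linv x) x.
by rewrite linv_mul mulg1.
Qed.

Lemma linvVKl x y : x * (linv x * y) = y.
Proof. by rewrite -{1}[x]linvK linvKl. Qed.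

Lemma linvVKr x y : (y * linv x) * x = y.
Proof. by rewrite -{2}[x]linvK linvKr. Qed.

Lemma linvM x y : linv (x * y) = linv y * linv x.
Proof.
have h : y * linv (x * y) = linv x by rewrite -{1}[y](linvKl x) linvKr.
by rewrite -h linvKl.
Qed.

End InverseProperty.

Definition has_order3 {L : loopType} (xi : L) : Prop :=
  xi <> 1 /\ (xi * xi) * xi = 1.

(* The inverse map and the cancellation laws are stored in the record; by
   [autP] two automorphisms are equal as soon as they agree pointwise. *)
Record aut (A : zmodType) := Aut {
  aut_fun :> A -> A;
  aut_inv : A -> A;
  autD : {morph aut_fun : a b / (a + b)%R};
  autK : cancel aut_fun aut_inv;
  autVK : cancel aut_inv aut_fun
}.

Section AutGroup.
Variable A : zmodType.
Implicit Types f g h : aut A.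

Lemma autP f g : f =1 g -> f = g.
Proof.
case: f g => [f f' fD fK fVK] [g g' gD gK gVK] /= efg.
have {}efg : f = g by apply: funext.
subst g; have e' : f' = g' by apply: funext => a; rewrite -{1}[a]gVK fK.
by subst g'; congr Aut; apply: Prop_irrelevance.
Qed.

Lemma aut_zmod_morphism f : zmod_morphism f.
Proof.
have f0 : f 0%R = 0%R by apply: (addrI (f 0%R)); rewrite -autD !addr0.
have fN a : f (- a)%R = (- f a)%R.
  by apply: (addrI (f a)); rewrite -autD !subrr.
by move=> a b; rewrite autD fN.
Qed.

HB.instance Definition _ f :=
  GRing.isZmodMorphism.Build A A f (aut_zmod_morphism f).

Definition aut_one : aut A :=
  @Aut A id id (fun a b => erefl) (fun a => erefl) (fun a => erefl).

Lemma aut_mulD f g : {morph f \o g : a b / (a + b)%R}.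
Proof. by move=> a b /=; rewrite !autD. Qed.

Definition aut_mul f g : aut A :=
  Aut (aut_mulD f g) (can_comp (@autK A f) (@autK A g))
    (can_comp (@autVK A g) (@autVK A f)).

Lemma aut_invD f : {morph aut_inv f : a b / (a + b)%R}.
Proof. by move=> a b; apply: (can_inj (@autK A f)); rewrite autD !autVK. Qed.

Definition aut_inverse f : aut A :=
  Aut (@aut_invD f) (@autVK A f) (@autK A f).

HB.instance Definition _ := gen_eqMixin (aut A).
HB.instance Definition _ := gen_choiceMixin (aut A).

Lemma aut_mulA : associative aut_mul.
Proof. by move=> f g h; apply: autP. Qed.
Lemma aut_1mul : left_id aut_one aut_mul.
Proof. by move=> f; apply: autP. Qed.
Lemma aut_mul1 : right_id aut_one aut_mul.
Proof. by move=> f; apply: autP. Qed.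
Lemma aut_mulV : left_inverse aut_one aut_inverse aut_mul.
Proof. by move=> f; apply: autP => a /=; rewrite autK. Qed.
Lemma aut_Vmul : right_inverse aut_one aut_inverse aut_mul.
Proof. by move=> f; apply: autP => a /=; rewrite autVK. Qed.

HB.instance Definition _ := isGroup.Build (aut A)
  aut_mulA aut_1mul aut_mul1 aut_mulV aut_Vmul.

Lemma aut1E a : (1 : aut A) a = a. Proof. by []. Qed.
Lemma autME f g a : (f * g) a = f (g a). Proof. by []. Qed.

End AutGroup.

Record loop_cocycle (A : zmodType) (L : loopType) := LoopCocycle {
  coP : L * L -> aut A;
  coQ : L * L -> aut A;
  coP1 : forall alpha : L, coP (alpha, 1) = 1;
  coQ1 : forall beta : L, coQ (1, beta) = 1
}.

(* A copy of [L * A] indexed by the cocycle, which carries the loop structure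
   of F(P,Q). *)
Definition linext (A : zmodType) (L : loopType) (c : loop_cocycle A L) : Type :=
  (L * A)%type.

Section LinExt.
Variables (A : zmodType) (L : loopType) (c : loop_cocycle A L).

HB.instance Definition _ := Choice.on (linext c).

Definition linext_mul (u v : linext c) : linext c :=
  (u.1 * v.1, (coP c (u.1, v.1) u.2 + coQ c (u.1, v.1) v.2)%R).

Definition linext_one : linext c := (1, 0%R).

HB.instance Definition _ := hasMul.Build (linext c) linext_mul.

Lemma linext_mul1g : left_id linext_one linext_mul.
Proof.
by case=> b x; rewrite /linext_mul /= mul1g coQ1 raddf0 add0r.
Qed.

Lemma linext_mulg1 : right_id linext_one linext_mul.
Proof.
by case=> b x; rewrite /linext_mul /= mulg1 coP1 raddf0 addr0.
Qed.

HB.instance Definition _ :=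
  Magma_isUMagma.Build (linext c) linext_mul1g linext_mulg1.

Lemma linext_lmul_bij (u : linext c) : bijective (fun v : linext c => u * v).
Proof.
case: u => al a; have [g gK gVK] := lmul_bij al.
exists (fun w : linext c =>
  (g w.1, aut_inv (coQ c (al, g w.1)) (w.2 - coP c (al, g w.1) a)%R)).
- by move=> [be b] /=; rewrite gK addrC addKr autK.
- by move=> [be b]; congr pair; rewrite /= ?gVK // autVK addrC subrK.
Qed.

Lemma linext_rmul_bij (u : linext c) : bijective (fun v : linext c => v * u).
Proof.
case: u => be b; have [g gK gVK] := rmul_bij be.
exists (fun w : linext c =>
  (g w.1, aut_inv (coP c (g w.1, be)) (w.2 - coQ c (g w.1, be) b)%R)).
- by move=> [al a] /=; rewrite gK addrK autK.
- by move=> [al a]; congr pair; rewrite /= ?gVK // autVK subrK.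
Qed.

HB.instance Definition _ :=
  UMagma_isLoop.Build (linext c) linext_lmul_bij linext_rmul_bij.

Definition strongly_linear_abelian : Prop :=
  forall (a b : A) (beta : L),
    let x : linext c := (1, a) in
    let y : linext c := (beta, b) in
    x * y = (beta, (a + b)%R) /\ y * x = (beta, (a + b)%R).

End LinExt.

(* The six elements of the group generated by the involutions phi and psi with
   (phi psi)^3 = 1; products act as composites, rightmost factor first. *)
Inductive Gamma :=
  | g_iota | g_phi | g_psi | g_phipsiphi | g_psiphi | g_phipsi.

Definition act_pair {L : loopType} (tau : Gamma) (x : L * L) : L * L :=
  let: (xi, eta) := x in
  match tau with
  | g_iota => (xi, eta)
  | g_phi => (linv xi, xi * eta)
  | g_psi => (xi * eta, linv eta)
  | g_phipsiphi => (linv eta, linv xi)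
  | g_psiphi => (eta, linv (xi * eta))
  | g_phipsi => (linv (xi * eta), xi)
  end.

Definition act_aut {A : zmodType} (tau : Gamma) (v : aut A * aut A) :
    aut A * aut A :=
  let: (P, Q) := v in
  match tau with
  | g_iota => (P, Q)
  | g_phi => (Q^-1 * P, Q^-1)
  | g_psi => (P^-1, P^-1 * Q)
  | g_phipsiphi => (Q, P)
  | g_psiphi => (P^-1 * Q, P^-1)
  | g_phipsi => (Q^-1, Q^-1 * P)
  end.

Section GammaActions.
Variables (A : zmodType) (L : loopType).

Lemma act_autE (v : aut A * aut A) :
  [/\ act_aut g_phi (act_aut g_phi v) = v,
      act_aut g_psi (act_aut g_psi v) = v,
      act_aut g_phipsi v = act_aut g_phi (act_aut g_psi v),
      act_aut g_psiphi v = act_aut g_psi (act_aut g_phi v) &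
      act_aut g_phipsiphi v = act_aut g_phi (act_aut g_psiphi v)].
Proof.
by case: v => P Q; split;
  rewrite /= ?invgM ?invgK ?mulgA ?mulgV ?mulVg ?mul1g ?mulgK ?mulgVK ?mulVg
    ?mul1g.
Qed.

Lemma act_aut_order3 (v : aut A * aut A) :
  act_aut g_phipsi (act_aut g_phipsi (act_aut g_phipsi v)) = v.
Proof.
by case: v => P Q; rewrite /= !(invgM, invgK) -?mulgA !(mulKg, mulVKg, mulVg, mulg1).
Qed.

Hypothesis hIP : inverse_property L.

Lemma act_pairE (x : L * L) :
  [/\ act_pair g_phi (act_pair g_phi x) = x,
      act_pair g_psi (act_pair g_psi x) = x,
      act_pair g_phipsi x = act_pair g_phi (act_pair g_psi x),
      act_pair g_psiphi x = act_pair g_psi (act_pair g_phi x) &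
      act_pair g_phipsiphi x = act_pair g_phi (act_pair g_psiphi x)].
Proof.
by case: x => xi eta; split;
  rewrite /= ?(linvM hIP, linvKl hIP, linvKr hIP, linvVKl hIP, linvK hIP).
Qed.

Lemma act_pair_order3 (x : L * L) :
  act_pair g_phipsi (act_pair g_phipsi (act_pair g_phipsi x)) = x.
Proof.
case: x => xi eta.
by rewrite /= !(linvM hIP, linvKl hIP, linvKr hIP, linvVKr hIP, linvK hIP).
Qed.

End GammaActions.

Definition Sigma {L : loopType} (x : L * L) : Prop :=
  exists xi : L, [\/ x = (xi, 1), x = (1, xi) | x = (linv xi, xi)].

Definition same_orbit {L : loopType} (x y : L * L) : Prop :=
  exists tau : Gamma, y = act_pair tau x.

Definition orbit_representatives {L : loopType} (R : L * L -> Prop) : Prop :=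
  (forall x, R x -> ~ Sigma x) /\
  (forall x, ~ Sigma x -> exists! r, R r /\ same_orbit r x).

(* [R] is the set of chosen orbit elements and [v] gives the values chosen on
   [R]; the values of [v] outside [R] are irrelevant. *)
Definition constructed_from {A : zmodType} {L : loopType}
    (R : L * L -> Prop) (v : L * L -> aut A * aut A)
    (P Q : L * L -> aut A) : Prop :=
  (forall x, Sigma x -> P x = 1 /\ Q x = 1) /\
  (forall r, R r -> (P r, Q r) = v r /\
     forall tau : Gamma,
       (P (act_pair tau r), Q (act_pair tau r)) = act_aut tau (P r, Q r)).

Definition obtained_by_construction {A : zmodType} {L : loopType}
    (c : loop_cocycle A L) : Prop :=
  exists (R : L * L -> Prop) (v : L * L -> aut A * aut A),
    orbit_representatives R /\ constructed_from R v (coP c) (coQ c).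

(* Main.v *)
Require Import Defs.
From HB Require Import structures.
From mathcomp Require Import all_boot.
From mathcomp Require Import monoid ssralg.
From mathcomp Require Import boolp.

(** The proof rests on one equivalence: a strongly linear abelian extension
    F(P,Q) has the inverse property if and only if the map (P, Q) commutes with
    the actions of Gamma.  If the inverse of (alpha, a) is (alpha^-1, -a), then
    comparing the coefficients of a and b in

      (alpha^-1, -a) . ((alpha, a) . (beta, b)) = (beta, b)

    gives Q(alpha^-1, alpha beta) = Q(alpha, beta)^-1 and
    P(alpha^-1, alpha beta) = Q(alpha, beta)^-1 P(alpha, beta), which is
    equivariance under phi; in the same way the right inverse law is
    equivariance under psi, and phi and psi generate Gamma.

    From equivariance to the inverse property this is a direct computation
    ([inverse_property_of_equivariant]).  In the other direction the inverse of
    (alpha, a) is not known at first, except for a = 0.  The case a = 0 of the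
    left law already gives the equation for Q above, and its special case
    beta = 1 shows that Q is trivial at all (alpha^-1, alpha); the right law
    does the same for P.  So P and Q are trivial on Sigma
    ([inverse_property_Sigma]), hence (alpha, a) has the inverse
    (alpha^-1, -a), and the comparison of coefficients applies
    ([inverse_property_equivariant]).

    What is left is the description of the equivariant maps on a set with a
    Gamma-action.  Sigma is stable under Gamma and the pair (1, 1) is fixed by
    Gamma, so the constant value on Sigma is equivariant.  Off Sigma the action
    is free: a fixed point of a reflection lies in Sigma directly, and a fixed
    point of a rotation has the form (xi, xi) with xi cubed trivial, which the
    absence of elements of order 3 excludes unless xi is the identity.  On a
    free action an equivariant map is the same thing as an arbitrary choice of
    values on a set of orbit representatives, and such a set exists by the axiom
    of choice. *)

Set Implicit Arguments.
Unset Strict Implicit.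
Unset Printing Implicit Defensive.

Import GRing.Theory.
Local Open Scope group_scope.

(** * The group structure of Gamma *)

Definition phi_mul (tau : Gamma) : Gamma :=
  match tau with
  | g_iota => g_phi
  | g_phi => g_iota
  | g_psi => g_phipsi
  | g_phipsiphi => g_psiphi
  | g_psiphi => g_phipsiphi
  | g_phipsi => g_psi
  end.

Definition psi_mul (tau : Gamma) : Gamma :=
  match tau with
  | g_iota => g_psi
  | g_phi => g_psiphi
  | g_psi => g_iota
  | g_phipsiphi => g_phipsi
  | g_psiphi => g_phi
  | g_phipsi => g_phipsiphi
  end.

(** Multiplication is spelled out through the two generators, so that a property
    of products need only be checked on left multiplication by phi and psi. *)
Definition gamma_mul (tau sigma : Gamma) : Gamma :=
  match tau with
  | g_iota => sigma
  | g_phi => phi_mul sigma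
  | g_psi => psi_mul sigma
  | g_phipsiphi => phi_mul (psi_mul (phi_mul sigma))
  | g_psiphi => psi_mul (phi_mul sigma)
  | g_phipsi => phi_mul (psi_mul sigma)
  end.

Definition gamma_inv (tau : Gamma) : Gamma :=
  match tau with
  | g_psiphi => g_phipsi
  | g_phipsi => g_psiphi
  | _ => tau
  end.

Lemma gamma_mulV tau : gamma_mul (gamma_inv tau) tau = g_iota.
Proof. by case: tau. Qed.

Lemma gamma_mulV_eq sigma tau : gamma_mul (gamma_inv sigma) tau = g_iota -> sigma = tau.
Proof. by case: sigma; case: tau. Qed.

Section Actions.
Variables (A : zmodType) (L : loopType).
Hypothesis hIP : inverse_property L.
Implicit Types (x : L * L) (w : aut A * aut A).

Lemma act_pair_mul tau sigma x :
  act_pair (gamma_mul tau sigma) x = act_pair tau (act_pair sigma x).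
Proof.
pose linvE := (linvM hIP, linvKl hIP, linvKr hIP, linvVKl hIP, linvVKr hIP).
have phiM s (y : L * L) : act_pair (phi_mul s) y = act_pair g_phi (act_pair s y).
  by case: y => xi eta; case: s; rewrite /= ?linvE ?(linvK hIP).
have psiM s (y : L * L) : act_pair (psi_mul s) y = act_pair g_psi (act_pair s y).
  by case: y => xi eta; case: s; rewrite /= ?linvE ?(linvK hIP).
have [_ _ fp pf fpf] := act_pairE hIP (act_pair sigma x).
case: tau; rewrite ?fpf ?fp ?pf /gamma_mul ?(phiM, psiM) //.
by case: (act_pair sigma x).
Qed.

Lemma act_aut_mul tau sigma w :
  act_aut (gamma_mul tau sigma) w = act_aut tau (act_aut sigma w).
Proof.
have phiM s (u : aut A * aut A) : act_aut (phi_mul s) u = act_aut g_phi (act_aut s u).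
  by case: u => P Q; case: s; rewrite /= ?(invgM, invgK) -?mulgA ?(mulKg, mulVKg, mulVg, mulgV, mulg1).
have psiM s (u : aut A * aut A) : act_aut (psi_mul s) u = act_aut g_psi (act_aut s u).
  by case: u => P Q; case: s; rewrite /= ?(invgM, invgK) -?mulgA ?(mulKg, mulVKg, mulVg, mulgV, mulg1).
have [_ _ fp pf fpf] := act_autE (act_aut sigma w).
case: tau; rewrite ?fpf ?fp ?pf /gamma_mul ?(phiM, psiM) //.
by case: (act_aut sigma w).
Qed.

Lemma act_aut1 tau : act_aut tau (1 : aut A, 1 : aut A) = (1, 1).
Proof. by case: tau; rewrite /= ?invg1 ?mulg1. Qed.

Lemma act_pairK tau x : act_pair (gamma_inv tau) (act_pair tau x) = x.
Proof. by rewrite -act_pair_mul gamma_mulV; case: x. Qed.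

Lemma same_orbit_refl x : same_orbit x x.
Proof. by exists g_iota; case: x. Qed.

Lemma same_orbit_sym x y : same_orbit x y -> same_orbit y x.
Proof. by move=> [tau ->]; exists (gamma_inv tau); rewrite act_pairK. Qed.

Lemma same_orbit_trans x y z : same_orbit x y -> same_orbit y z -> same_orbit x z.
Proof.
by move=> [s ->] [t ->]; exists (gamma_mul t s); rewrite act_pair_mul.
Qed.

(** * Sigma and the free part of the action *)

Lemma linv1 : linv (1 : L) = 1.
Proof. by rewrite -[LHS]mul1g mul_linv. Qed.

(** Sigma is the union of three sets which the generators permute: phi exchanges
    the first and the third and keeps the second, psi exchanges the second and
    the third and keeps the first. *)
Lemma Sigma_act tau x : Sigma x -> Sigma (act_pair tau x).
Proof.
have phiS (y : L * L) : Sigma y -> Sigma (act_pair g_phi y).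
  case=> xi [] -> /=.
  - by rewrite mulg1; exists xi; constructor 3.
  - by rewrite linv1 mul1g; exists xi; constructor 2.
  - by rewrite (linvK hIP) (linv_mul hIP); exists xi; constructor 1.
have psiS (y : L * L) : Sigma y -> Sigma (act_pair g_psi y).
  case=> xi [] -> /=.
  - by rewrite linv1 mulg1; exists xi; constructor 1.
  - rewrite mul1g; exists (linv xi); constructor 3.
    by rewrite (linvK hIP).
  - by rewrite (linv_mul hIP); exists (linv xi); constructor 2.
move=> Sx; have [_ _ fp pf fpf] := act_pairE hIP x.
case: tau; rewrite ?fpf ?fp ?pf; auto.
by case: x Sx {fp pf fpf}.
Qed.

Lemma Sigma_actE tau x : Sigma (act_pair tau x) <-> Sigma x.
Proof.
by split=> [/(Sigma_act (gamma_inv tau))|/(Sigma_act tau)//]; rewrite act_pairK.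
Qed.

Hypothesis hord3 : forall xi : L, ~ has_order3 xi.

Lemma cube1 (xi : L) : (xi * xi) * xi = 1 -> xi = 1.
Proof. by move=> h; apply: contrapT => nxi; apply: (hord3 (xi := xi)). Qed.

Lemma act_pair_fixed tau x : act_pair tau x = x -> tau = g_iota \/ Sigma x.
Proof.
case: x => xi eta; case: tau => /= [_|[_ h]|[h _]|[h _]|[h1 h2]|[h1 h2]];
  first [by left | right].
- have -> : xi = 1 by rewrite -(linvKr hIP eta xi) h mul_linv.
  by exists eta; constructor 2.
- have -> : eta = 1 by rewrite -(linvKl hIP xi eta) h (linv_mul hIP).
  by exists xi; constructor 1.
- by exists eta; constructor 3; rewrite h.
- (* Here eta = xi and (xi xi)^-1 = xi, so xi has trivial cube. *)
  rewrite h1 in h2 *; have -> : xi = 1.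
    by apply: cube1; rewrite -[X in _ * X]h2 mul_linv.
  by exists 1; constructor 1.
- rewrite h2 in h1 *; have -> : eta = 1.
    by apply: cube1; rewrite -[X in _ * X]h1 mul_linv.
  by exists 1; constructor 1.
Qed.

Lemma act_pair_free sigma tau x :
  ~ Sigma x -> act_pair sigma x = act_pair tau x -> sigma = tau.
Proof.
move=> nS e; apply: gamma_mulV_eq.
by case: (@act_pair_fixed (gamma_mul (gamma_inv sigma) tau) x) => //;
  rewrite act_pair_mul -e act_pairK.
Qed.

(** * Orbit representatives and equivariant maps *)

(** The canonical choice operator returns the same point for two extensionally
    equal predicates, hence for two points of one orbit; its fixed points
    outside Sigma are the representatives. *)
Lemma orbit_representatives_exist :
  exists R : L * L -> Prop, orbit_representatives R.
Proof.
pose rep x := choose (fun y => `[< same_orbit x y >]) x.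
have repP x : same_orbit x (rep x).
  by apply/asboolP/(chooseP (P := fun y => `[< same_orbit x y >]))/asboolP/same_orbit_refl.
have repE x y : same_orbit x y -> rep x = rep y.
  move=> xy; rewrite /rep.
  have -> : (fun z => `[< same_orbit x z >]) = (fun z => `[< same_orbit y z >]).
    apply: funext => z; apply/asbool_equiv_eq; split; apply: same_orbit_trans => //.
    exact: same_orbit_sym.
  by apply: choose_id; apply/asboolP; [exact: same_orbit_sym | exact: same_orbit_refl].
exists (fun x => ~ Sigma x /\ rep x = x); split=> [x []//|x nS].
exists (rep x); split=> [|r [[_ rr] rx]]; last by rewrite -(repE _ _ rx).
split; last exact/same_orbit_sym/repP.
split; last by rewrite -(repE _ _ (repP x)).
by have [tau ->] := repP x; rewrite Sigma_actE.
Qed.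

Implicit Types (R : L * L -> Prop) (v : L * L -> aut A * aut A) (P Q : L * L -> aut A).

Definition equivariant (P Q : L * L -> aut A) : Prop :=
  forall tau x, (P (act_pair tau x), Q (act_pair tau x)) = act_aut tau (P x, Q x).

Lemma constructed_equivariant R v P Q :
  orbit_representatives R -> constructed_from R v P Q -> equivariant P Q.
Proof.
move=> [_ Rrep] [PQS PQR] tau x.
have [Sx|nSx] := pselect (Sigma x).
  have [-> ->] := PQS _ (Sigma_act tau Sx); have [-> ->] := PQS _ Sx.
  by rewrite act_aut1.
have [r [[Rr [sigma ->]] _]] := Rrep _ nSx; have [_ eqv] := PQR _ Rr.
by rewrite -act_pair_mul !eqv act_aut_mul.
Qed.

(** Freeness is what makes the prescription consistent: a point off Sigma is
    [act_pair tau r] for only one [tau] and only one representative [r]. *)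
Lemma construction_exists R v : orbit_representatives R ->
  exists P Q : L * L -> aut A, constructed_from R v P Q.
Proof.
move=> [RnS Rrep].
have pw x : exists w : aut A * aut A, (Sigma x -> w = (1, 1)) /\
    (forall r tau, R r -> x = act_pair tau r -> w = act_aut tau (v r)).
  have [Sx|nSx] := pselect (Sigma x).
    exists (1, 1); split=> // r tau Rr xE.
    by case: (RnS _ Rr); apply/(Sigma_actE tau); rewrite -xE.
  have [r [[Rr [tau xE]] rU]] := Rrep _ nSx.
  exists (act_aut tau (v r)); split=> // r' tau' Rr' xE'.
  have rr' : r = r' by apply: rU; split=> //; exists tau'.
  subst r'; congr act_aut; apply: (act_pair_free (RnS _ Rr)).
  by rewrite -xE -xE'.
have [f fP] := choice pw.
exists (fun x => (f x).1), (fun x => (f x).2); split=> [x Sx|r Rr].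
  by rewrite (fP x).1.
have act1 w : act_aut g_iota w = w by case: w.
have fr : f r = v r.
  by rewrite -[RHS]act1; apply: (fP r).2 => //; case: (r).
split=> [|tau]; rewrite -!surjective_pairing //.
by rewrite fr; apply: (fP _).2.
Qed.

Lemma construction_unique R v P Q P' Q' : orbit_representatives R ->
  constructed_from R v P Q -> constructed_from R v P' Q' -> P = P' /\ Q = Q'.
Proof.
move=> [_ Rrep] [PQS PQR] [PQS' PQR'].
have e x : (P x, Q x) = (P' x, Q' x).
  have [Sx|nSx] := pselect (Sigma x).
    by have [-> ->] := PQS _ Sx; have [-> ->] := PQS' _ Sx.
  have [r [[Rr [tau ->]] _]] := Rrep _ nSx.
  have [er ->] := PQR _ Rr; have [er' ->] := PQR' _ Rr.
  by rewrite er er'.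
by split; apply: funext => x; case: (e x).
Qed.

End Actions.

(** * Equivariance and the inverse property of F(P,Q) *)

Section Extension.
Variables (A : zmodType) (L : loopType).
Hypothesis hIP : inverse_property L.
Implicit Type c : loop_cocycle A L.

Lemma loop_cocycle_eq c c' : coP c = coP c' -> coQ c = coQ c' -> c = c'.
Proof.
case: c c' => [P Q p q] [P' Q' p' q'] /= eP eQ; subst P' Q'.
by congr LoopCocycle; apply: Prop_irrelevance.
Qed.

Lemma strongly_linear_abelianP c :
  strongly_linear_abelian c <->
  forall be, coP c (1, be) = 1 /\ coQ c (be, 1) = 1.
Proof.
split=> [h be|h a b be].
  split; apply: autP => a; have := h a 0%R be.
    by case=> -[_]; rewrite /= raddf0 !addr0.
  by case=> _ -[_]; rewrite /= raddf0 add0r addr0.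
have [eP eQ] := h be.
by split; congr pair; rewrite /= ?mul1g ?mulg1 // ?eP ?eQ ?coP1 ?coQ1 // addrC.
Qed.

(** The candidate inverse map is (alpha, a) |-> (alpha^-1, -a).  Equivariance
    under phi turns the left inverse law into
    Q^-1 P (-a) + Q^-1 (P a + Q b) = b, with P and Q taken at (alpha, beta), and
    equivariance under psi does the same for the right law. *)
Lemma inverse_property_of_equivariant c :
  equivariant (coP c) (coQ c) -> inverse_property (linext c).
Proof.
move=> eqv.
pose i (u : linext c) : linext c := (linv u.1, (- u.2)%R).
have iB : bijective i.
  by apply: inv_bij => -[al a]; rewrite /i /= (linvK hIP) opprK.
split; exists i; split=> // -[al a] [be b].
- have [eP eQ] := eqv g_phi (al, be).
  by congr pair; rewrite /= ?(linvKl hIP) // eP eQ autME -autD raddfN addKr -autME mulVg.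
- have [eP eQ] := eqv g_psi (be, al).
  congr pair; rewrite /= ?(linvKr hIP) // eP eQ autME.
  by rewrite -autD raddfN addrK -autME mulVg.
Qed.

Lemma linv_uniq (M : loopType) (x y : M) : x * y = 1 -> linv x = y.
Proof. by move=> h; apply: (bij_inj (lmul_bij x)); rewrite mul_linv h. Qed.

Lemma equivariant_generators (P Q : L * L -> aut A) :
  (forall x, (P (act_pair g_phi x), Q (act_pair g_phi x)) = act_aut g_phi (P x, Q x)) ->
  (forall x, (P (act_pair g_psi x), Q (act_pair g_psi x)) = act_aut g_psi (P x, Q x)) ->
  equivariant P Q.
Proof.
move=> ephi epsi tau x.
have [_ _ fp pf fpf] := act_pairE hIP x.
have [_ _ fp' pf' fpf'] := act_autE (P x, Q x).
case: tau => //; first by case: x {fp pf fpf fp' pf' fpf'}.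
- by rewrite fpf pf fpf' pf' ephi epsi ephi.
- by rewrite pf pf' epsi ephi.
- by rewrite fp fp' ephi epsi.
Qed.

Section InverseImplies.
Variable c : loop_cocycle A L.
Hypotheses (sla : strongly_linear_abelian c) (cIP : inverse_property (linext c)).

Lemma coPQ_unit be : coP c (1, be) = 1 /\ coQ c (be, 1) = 1.
Proof. exact: (strongly_linear_abelianP c).1. Qed.

Lemma linext_linv0 al : linv ((al, 0%R) : linext c) = (linv al, 0%R).
Proof. by apply: linv_uniq; congr pair; rewrite /= ?mul_linv // !raddf0 addr0. Qed.

(** The left inverse law for [(alpha, 0)], whose inverse [(alpha^-1, 0)] is
    known without any information on P and Q. *)
Lemma coQ_phi al be : coQ c (linv al, al * be) = (coQ c (al, be))^-1.
Proof.
apply: (mulIg (coQ c (al, be))); rewrite mulVg; apply: autP => b.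
have := linvKl cIP ((al, 0%R) : linext c) (be, b).
by rewrite linext_linv0 => -[_]; rewrite !raddf0 !add0r.
Qed.

Lemma coP_psi al be : coP c (al * be, linv be) = (coP c (al, be))^-1.
Proof.
apply: (mulIg (coP c (al, be))); rewrite mulVg; apply: autP => a.
have := linvKr cIP ((be, 0%R) : linext c) (al, a).
by rewrite linext_linv0 => -[_]; rewrite !raddf0 !addr0.
Qed.

(** On the pairs [(xi^-1, xi)], [coQ_phi] at [beta = 1] and [coP_psi] at [alpha = 1]
    reduce to the values of Q on [L * 1] and of P on [1 * L]. *)
Lemma inverse_property_Sigma x : Sigma x -> coP c x = 1 /\ coQ c x = 1.
Proof.
case=> xi [] ->.
- by rewrite coP1 (coPQ_unit xi).2.
- by rewrite coQ1 (coPQ_unit xi).1.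
split.
- by have := coP_psi 1 (linv xi); rewrite mul1g (linvK hIP) (coPQ_unit _).1 invg1.
- by have := coQ_phi xi 1; rewrite mulg1 (coPQ_unit _).2 invg1.
Qed.

(** By triviality of P and Q at [(alpha, alpha^-1)], which lies in Sigma. *)
Lemma linext_linv al a : linv ((al, a) : linext c) = (linv al, (- a)%R).
Proof.
apply: linv_uniq; congr pair; rewrite /= ?mul_linv //.
have [-> ->] : coP c (al, linv al) = 1 /\ coQ c (al, linv al) = 1.
  by apply: inverse_property_Sigma; exists (linv al); constructor 3; rewrite (linvK hIP).
by rewrite subrr.
Qed.

(** The equation for P under phi is the left inverse law for [(alpha, a)] applied
    to [(beta, 0)], that for Q under psi the right law applied to [(alpha, 0)]. *)
Lemma inverse_property_equivariant : equivariant (coP c) (coQ c).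
Proof.
apply: equivariant_generators => -[al be] /=.
- rewrite coQ_phi; congr pair; apply: autP => a.
  have := linvKl cIP ((al, a) : linext c) (be, 0%R).
  rewrite linext_linv => -[_]; rewrite coQ_phi raddfN raddf0 addr0 => /eqP.
  by rewrite addrC subr_eq0 => /eqP <-.
- rewrite coP_psi; congr pair; apply: autP => b.
  have := linvKr cIP ((be, b) : linext c) (al, 0%R).
  rewrite linext_linv => -[_]; rewrite coP_psi raddfN raddf0 add0r => /eqP.
  by rewrite subr_eq0 => /eqP <-.
Qed.

End InverseImplies.

End Extension.

(* The first conjunct says that the construction makes sense: any choice of
   orbit representatives and of values on them determines exactly one pair
   (P, Q), and it gives a strongly linear abelian extension. *)
Theorem corollary11 (A : zmodType) (L : loopType)
    (hIP : inverse_property L)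
    (hord3 : forall xi : L, ~ has_order3 xi) :
  (forall (R : L * L -> Prop) (v : L * L -> aut A * aut A),
     orbit_representatives R ->
     exists! c : loop_cocycle A L,
       strongly_linear_abelian c /\ constructed_from R v (coP c) (coQ c))
  /\ (forall c : loop_cocycle A L,
        strongly_linear_abelian c -> obtained_by_construction c ->
        inverse_property (linext c))
  /\ (forall c : loop_cocycle A L,
        strongly_linear_abelian c -> inverse_property (linext c) ->
        obtained_by_construction c).
Proof.
split; [|split].
- move=> R v Rrep.
  have [P [Q PQ]] := construction_exists hIP hord3 v Rrep.
  have PQS := PQ.1.
  have P1 al : P (al, 1) = 1.
    by apply: (PQS _ _).1; exists al; constructor 1.
  have Q1 be : Q (1, be) = 1.
    by apply: (PQS _ _).2; exists be; constructor 2.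
  exists (LoopCocycle P1 Q1); split.
    split=> //; apply/strongly_linear_abelianP => be; split.
      by apply: (PQS _ _).1; exists be; constructor 2.
    by apply: (PQS _ _).2; exists be; constructor 1.
  move=> c [_ cPQ].
  have [eP eQ] := construction_unique Rrep PQ cPQ.
  exact: loop_cocycle_eq.
- move=> c _ [R [v [Rrep PQ]]].
  exact/(inverse_property_of_equivariant hIP)/(constructed_equivariant hIP Rrep PQ).
- move=> c sla cIP; have [R Rrep] := orbit_representatives_exist hIP.
  exists R, (fun x => (coP c x, coQ c x)); split=> //; split=> [x|r _].
    exact: inverse_property_Sigma.
  by split=> // tau; apply: inverse_property_equivariant.
Qed.
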